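(* Let $\tau>0$ and $\gamma>0$. With the setting and notation of the context (symmetric positive definite $A\in\mathbb{R}^{n\times n}$, overlapping decomposition into $N$ subdomains, near-kernel subspace $G$, arbitrary symmetric positive definite local matrices $B_i$, coarse space $V_0=V_G+V^\tau_{geneo}+V^\gamma_{geneo}$ with basis matrix $Z$, and $P_0=Z(Z^TAZ)^{-1}Z^TA$), define the SORAS with GenEO preconditioner $$M^{-1}_{SORAS,2}:=P_0A^{-1}+(I-P_0)\sum_{i=1}^N R_i^TD_iB_i^{-1}D_iR_i\,(I-P_0^T).$$ Then the spectral condition number of the preconditioned operator satisfies $$\kappa(M^{-1}_{SORAS,2}A)\le(1+k_1\tau)\max(1,k_0\gamma).$$
   Context: All scalar products $(\cdot,\cdot)$ are Euclidean. $A\in\mathbb{R}^{n\times n}$ is a symmetric positive definite (SPD) matrix arising from a conforming finite element discretisation of a symmetric coercive bilinear form $a$ on a domain $\Omega$; write $a(\mathbf U,\mathbf V)=(A\mathbf U,\mathbf V)$. The form is a sum over mesh elements, $a=\sum_{K} a_K$, with each $a_K$ a symmetric positive semidefinite bilinear form on $\mathbb{R}^n$. $\Omega$ is covered by $N$ overlapping subdomains $\Omega_i$, each a union of mesh elements. $R_i\in\mathbb{R}^{n_i\times n}$ is the Boolean restriction matrix selecting the $n_i$ degrees of freedom of $\Omega_i$. $D_i\in\mathbb{R}^{n_i\times n_i}$ are diagonal matrices forming a partition of unity: $\sum_{i=1}^N R_i^TD_iR_i=I$. The local Neumann matrix $A_i^{Neu}\in\mathbb{R}^{n_i\times n_i}$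 is defined by $(A_i^{Neu}R_i\mathbf U,R_i\mathbf V)=\sum_{K\subset\Omega_i}a_K(\mathbf U,\mathbf V)$ for all $\mathbf U,\mathbf V\in\mathbb{R}^n$ (the right side depends only on $R_i\mathbf U,R_i\mathbf V$), and is assumed SPD. $k_0:=\max_{1\le i\le N}\#\{j : R_jAR_i^T\neq 0\}$ is the maximal number of neighbours of a subdomain (including itself). $k_1$ is the maximal multiplicity of subdomain intersections, i.e. the largest number of subdomains sharing a common mesh element. $G\subset\mathbb{R}^n$ is a given subspace (the near-kernel of $A$), $G_i:=R_iG\subset\mathbb{R}^{n_i}$, and $V_G:=\sum_{i=1}^N R_i^TD_iG_i\subset\mathbb{R}^n$. For each $i$, $B_i\in\mathbb{R}^{n_i\times n_i}$ is a given SPD matrix, $G_i^{\perp_{B_i}}:=\{\mathbf U_i\in\mathbb{R}^{n_i}: (B_i\mathbf U_i,\mathbf V_i)=0\ \forall\,\mathbf V_i\in G_i\}$, and $\xi_{0i}$ is the $B_i$-orthogonal projection of $\mathbb{R}^{n_i}$ onto $G_i$ (parallel to $G_i^{\perp_{B_i}}$). GenEO coarse spaces. (i) For each $1\le j\le N$, let $(\mathbf V_{jk})_k$ be a basis of $\mathbb{R}^{n_j}$ of eigenvectors, with eigenvalues $\lambda_{jk}\in\mathbb{R}$, of $$(I-\xi_{0j}^T)B_j(I-\xi_{0j})\mathbf V_{jk}=\lambda_{jk}A_j^{Neu}\mathbf V_{jk}.$$ $V^\tau_{geneo}\subset\mathbb{R}^n$ is the span of all vectors $R_j^TD_j(I-\xi_{0j})\mathbf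 V_{jk}$ with $1\le j\le N$, $\lambda_{jk}>\tau$. (ii) For each $1\le i\le N$, let $(\mathbf U_{ik})_k$ be a basis of $G_i^{\perp_{B_i}}$ of eigenvectors, with eigenvalues $\mu_{ik}\in\mathbb{R}$, of the problem $$(D_iR_iAR_i^TD_i\mathbf U_{ik},\mathbf W)=\mu_{ik}(B_i\mathbf U_{ik},\mathbf W)\qquad\forall\,\mathbf W\in G_i^{\perp_{B_i}}.$$ $V^\gamma_{geneo}\subset\mathbb{R}^n$ is the span of all vectors $R_i^TD_i\mathbf U_{ik}$ with $1\le i\le N$, $\mu_{ik}>\gamma$. The coarse space is $V_0:=V_G+V^\tau_{geneo}+V^\gamma_{geneo}$, and $Z$ is a full-column-rank matrix whose columns form a basis of $V_0$. $P_0=Z(Z^TAZ)^{-1}Z^TA$ is then the $A$-orthogonal projection onto $V_0$. For an SPD $M^{-1}$, $\kappa(M^{-1}A)$ denotes the ratio of the largest to the smallest eigenvalue of $M^{-1}A$. *)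

(* Defs.v *)
From HB Require Import structures.
From mathcomp Require Import all_boot all_order all_algebra.
From mathcomp Require Import reals.

Set Implicit Arguments.
Unset Strict Implicit.
Unset Printing Implicit Defensive.

Import Order.TTheory GRing.Theory Num.Theory.

Local Open Scope ring_scope.

Definition dot (R : realType) (m : nat) (u v : 'cV[R]_m) : R :=
  \sum_i u i 0 * v i 0.

Definition spd (R : realType) (m : nat) (M : 'M[R]_m) : Prop :=
  M^T = M /\ forall u : 'cV[R]_m, u != 0 -> 0 < dot (M *m u) u.

Definition mximg (R : realType) (p q : nat) (M : 'M[R]_(p, q))
    (W : {vspace 'cV[R]_q}) : {vspace 'cV[R]_p} :=
  (linfun (mulmx M) @: W)%VS.

(* [r] lists the indices in [S], each exactly once and in any order (the local
   numbering), and [Rm] maps U to (U_(r k))_k. *)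
Definition boolean_restriction (R : realType) (n m : nat) (S : {set 'I_n})
    (Rm : 'M[R]_(m, n)) : Prop :=
  exists r : 'I_m -> 'I_n,
    [/\ injective r, [set r k | k : 'I_m] = S & Rm = rowsub r 1%:M].

(* { U | (B U, V) = 0 for all V in W }; see [mem_orthB]. *)
Definition orthB (R : realType) (m : nat) (B : 'M[R]_m)
    (W : {vspace 'cV[R]_m}) : {vspace 'cV[R]_m} :=
  (\bigcap_(k < \dim W) lker (linfun (mulmx ((tnth (vbasis W) k)^T *m B))))%VS.

Lemma dot_mulmx (R : realType) (m : nat) (B : 'M[R]_m) (u v : 'cV[R]_m) :
  v^T *m B *m u = (dot (B *m u) v)%:M.
Proof.
rewrite -mulmxA [LHS]mx11_scalar mxE; congr (_%:M).
by apply: eq_bigr => i _; rewrite mxE mulrC.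
Qed.

Lemma mem_orthB (R : realType) (m : nat) (B : 'M[R]_m)
    (W : {vspace 'cV[R]_m}) (u : 'cV[R]_m) :
  u \in orthB B W <-> forall v, v \in W -> dot (B *m u) v = 0.
Proof.
have kerE (v : 'cV[R]_m) :
    (u \in lker (linfun (mulmx (v^T *m B)))) = (dot (B *m u) v == 0).
  rewrite memv_ker lfunE /= dot_mulmx.
  by apply/eqP/eqP => [/matrixP/(_ 0 0)|->]; rewrite ?raddf0 // !mxE mulr1n.
rewrite memvE; split=> [/subv_bigcapP uW v vW|uW]; last first.
  apply/subv_bigcapP => k _; rewrite -memvE kerE; apply/eqP/uW.
  by apply: vbasis_mem; apply: mem_tnth.
rewrite (coord_vbasis vW) /dot.
under eq_bigr do rewrite summxE mulr_sumr.
rewrite exchange_big big1 //= => k _.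
have := uW k isT; rewrite -memvE kerE (tnth_nth 0) => /eqP uk0.
rewrite -[RHS](mulr0 (coord (vbasis W) k v)) -[in RHS]uk0 /dot mulr_sumr.
by apply: eq_bigr => i _; rewrite -mulrCA; congr (_ * _); rewrite mxE.
Qed.

(* X is the matrix of the projection onto W parallel to [orthB B W]. *)
Definition orthB_projection (R : realType) (m : nat) (B : 'M[R]_m)
    (W : {vspace 'cV[R]_m}) (X : 'M[R]_m) : Prop :=
  forall u : 'cV[R]_m, X *m u \in W /\ u - X *m u \in orthB B W.

(* kappa is the ratio of the largest to the smallest eigenvalue of M.  The
   library's [eigenvalue] refers to row eigenvectors (v *m M = a *: v), which
   yields the same eigenvalues as column eigenvectors. *)
Definition spectral_condition_number (R : realType) (m : nat) (M : 'M[R]_m)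
    (kappa : R) : Prop :=
  exists lmin lmax : R,
    [/\ eigenvalue M lmin, eigenvalue M lmax,
        forall l, eigenvalue M l -> lmin <= l <= lmax
      & kappa = lmax / lmin].

Definition max_neighbours (R : realType) (n N : nat) (n_ : 'I_N -> nat)
    (A : 'M[R]_n) (Rm : forall i, 'M[R]_(n_ i, n)) : nat :=
  \max_(i < N) #|[set j : 'I_N | (Rm j *m A *m (Rm i)^T != 0)%R]|.

(* Subdomain i is the union of the mesh elements in [Om i]. *)
Definition max_multiplicity (mesh : finType) (N : nat)
    (Om : 'I_N -> {set mesh}) : nat :=
  \max_(K : mesh) #|[set i : 'I_N | K \in Om i]|.

Definition coarse_G (R : realType) (n N : nat) (n_ : 'I_N -> nat)
    (Rm : forall i, 'M[R]_(n_ i, n)) (D : forall i, 'M[R]_(n_ i))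
    (G : {vspace 'cV[R]_n}) : {vspace 'cV[R]_n} :=
  (\sum_(i < N) mximg ((Rm i)^T *m D i) (mximg (Rm i) G))%VS.

Definition coarse_tau (R : realType) (n N : nat) (n_ : 'I_N -> nat)
    (Rm : forall i, 'M[R]_(n_ i, n)) (D xi : forall i, 'M[R]_(n_ i))
    (V : forall j, (n_ j).-tuple 'cV[R]_(n_ j))
    (lambda : forall j, 'I_(n_ j) -> R) (tau : R) : {vspace 'cV[R]_n} :=
  (\sum_(j < N) \sum_(k < n_ j | (tau < lambda j k)%R)
     <[ (Rm j)^T *m D j *m (1%:M - xi j) *m tnth (V j) k ]>)%VS.

Definition coarse_gamma (R : realType) (n N : nat) (n_ : 'I_N -> nat)
    (Rm : forall i, 'M[R]_(n_ i, n)) (D : forall i, 'M[R]_(n_ i))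
    (d_ : 'I_N -> nat) (U : forall i, (d_ i).-tuple 'cV[R]_(n_ i))
    (mu : forall i, 'I_(d_ i) -> R) (gamma : R) : {vspace 'cV[R]_n} :=
  (\sum_(i < N) \sum_(k < d_ i | (gamma < mu i k)%R)
     <[ (Rm i)^T *m D i *m tnth (U i) k ]>)%VS.

Definition coarse_projection (R : realType) (n m : nat) (A : 'M[R]_n)
    (Z : 'M[R]_(n, m)) : 'M[R]_n :=
  Z *m invmx (Z^T *m A *m Z) *m Z^T *m A.

Definition soras2 (R : realType) (n N m : nat) (n_ : 'I_N -> nat)
    (A : 'M[R]_n) (Rm : forall i, 'M[R]_(n_ i, n))
    (D B : forall i, 'M[R]_(n_ i)) (Z : 'M[R]_(n, m)) : 'M[R]_n :=
  let P0 := coarse_projection A Z in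
  P0 *m invmx A
  + (1%:M - P0)
    *m (\sum_(i < N) (Rm i)^T *m D i *m invmx (B i) *m D i *m Rm i)
    *m (1%:M - P0^T).

(* Main.v *)
Require Import Defs.
From HB Require Import structures.
From mathcomp Require Import all_boot all_order all_algebra.
From mathcomp Require Import reals.
From mathcomp Require Import complex polyrcf ring lra.

Set Implicit Arguments.
Unset Strict Implicit.
Unset Printing Implicit Defensive.

Import Order.TTheory GRing.Theory Num.Theory.

Local Open Scope ring_scope.

(** Write [Q = 1 - P0], [T_i = R_i^T D_i] and [g_i = T_i^T A Q u].  The
    preconditioned operator is self-adjoint for the [A]-product, and
    [(M^-1 A u, u)_A = |P0 u|_A^2 + sum_i (B_i^-1 g_i, g_i)].  Since [Q] kills
    the coarse space, [Q sum_i T_i z_i] is unchanged when each [z_i] loses its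
    component in [G_i] and its components on the eigenvectors put in the coarse
    space.
    Upper bound: for [mu <= gamma] what remains of [z_i] has [A]-energy at most
    [gamma (B_i z_i, z_i)], and the [N] contributions add up with constant [k0].
    Lower bound: [Q u = Q sum_i T_i z_i] where [z_i] is [1 - xi_i] applied to the
    part of [R_i u] with [lambda <= tau], so that the [B_i]-energies of the
    [z_i] add up to at most [k1 tau |u|_A^2].  In both cases Young's inequality
    converts the bound on the decomposition into one on [M^-1 A]. *)

(** * Scalar products and symmetric positive definite matrices *)

Section Dot.
Variables (R : realType).
Implicit Types (m p : nat).

Lemma dotC m (u v : 'cV[R]_m) : dot u v = dot v u.
Proof. by apply: eq_bigr => i _; rewrite mulrC. Qed.

Lemma dotDl m (u v w : 'cV[R]_m) : dot (u + v) w = dot u w + dot v w.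
Proof. by rewrite -big_split; apply: eq_bigr => i _; rewrite mxE mulrDl. Qed.

Lemma dotZl m a (u w : 'cV[R]_m) : dot (a *: u) w = a * dot u w.
Proof. by rewrite mulr_sumr; apply: eq_bigr => i _; rewrite mxE mulrA. Qed.

Lemma dotDr m (u v w : 'cV[R]_m) : dot w (u + v) = dot w u + dot w v.
Proof. by rewrite dotC dotDl !(dotC w). Qed.

Lemma dotZr m a (u w : 'cV[R]_m) : dot w (a *: u) = a * dot w u.
Proof. by rewrite dotC dotZl dotC. Qed.

Lemma dotNl m (u w : 'cV[R]_m) : dot (- u) w = - dot u w.
Proof. by rewrite -scaleN1r dotZl mulN1r. Qed.

Lemma dotNr m (u w : 'cV[R]_m) : dot w (- u) = - dot w u.
Proof. by rewrite dotC dotNl dotC. Qed.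

Lemma dot0l m (w : 'cV[R]_m) : dot 0 w = 0.
Proof. by rewrite -(scale0r 0) dotZl mul0r. Qed.

Lemma dot_suml m (I : Type) (r : seq I) (P : pred I) (F : I -> 'cV[R]_m) w :
  dot (\sum_(i <- r | P i) F i) w = \sum_(i <- r | P i) dot (F i) w.
Proof.
by elim/big_rec2: _ => [|i y x _ <-]; rewrite ?dot0l // dotDl.
Qed.

Lemma dot_sumr m (I : Type) (r : seq I) (P : pred I) (F : I -> 'cV[R]_m) w :
  dot w (\sum_(i <- r | P i) F i) = \sum_(i <- r | P i) dot w (F i).
Proof. by rewrite dotC dot_suml; apply: eq_bigr => i _; rewrite dotC. Qed.

Lemma dot_mulmxl m p (M : 'M[R]_(m, p)) u v :
  dot (M *m u) v = dot u (M^T *m v).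
Proof.
rewrite /dot; under eq_bigr do rewrite mxE mulr_suml.
rewrite exchange_big; apply: eq_bigr => j _; rewrite mxE mulr_sumr.
by apply: eq_bigr => i _; rewrite mxE mulrCA mulrA.
Qed.

Lemma dot_mulmxr m p (M : 'M[R]_(m, p)) u v :
  dot u (M *m v) = dot (M^T *m u) v.
Proof. by rewrite dot_mulmxl trmxK. Qed.

Lemma dot_sym m (S : 'M[R]_m) u v :
  S^T = S -> dot (S *m u) v = dot (S *m v) u.
Proof. by move=> symS; rewrite dot_mulmxl symS dotC. Qed.

Lemma spd_ge0 m (S : 'M[R]_m) u : spd S -> 0 <= dot (S *m u) u.
Proof.
case=> _ Spos; have [->|/Spos/ltW //] := eqVneq u 0.
by rewrite mulmx0 dot0l.
Qed.

Lemma spd_inj m (S : 'M[R]_m) (u : 'cV[R]_m) : spd S -> S *m u = 0 -> u = 0.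
Proof.
case=> _ Spos Su0; apply/eqP; apply: contraT => /Spos.
by rewrite Su0 dot0l ltxx.
Qed.

Lemma spd_unitmx m (S : 'M[R]_m) : spd S -> S \in unitmx.
Proof.
move=> Sspd; rewrite -row_full_unit; apply/row_fullP.
(* [kermx] is a left kernel: its rows for [S^T], transposed, are null vectors of [S]. The right
   inverse of [S^T] then transposes to a left inverse of [S]. *)
have: row_free S^T.
  rewrite -kermx_eq0; apply/eqP/row_matrixP => i; rewrite row0.
  have: S *m (row i (kermx S^T))^T = 0.
    by apply: trmx_inj; rewrite trmx_mul trmxK -row_mul mulmx_ker row0 trmx0.
  by move/(spd_inj Sspd)/(congr1 trmx); rewrite trmxK trmx0.
case/row_freeP => X SX; exists X^T.
by apply: trmx_inj; rewrite trmx_mul trmxK SX trmx1.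
Qed.

Lemma dot_invmx m (S : 'M[R]_m) u : spd S ->
  dot (invmx S *m u) u = dot (S *m (invmx S *m u)) (invmx S *m u).
Proof. by move=> Sspd; rewrite mulKVmx ?spd_unitmx // dotC. Qed.

(** Expand the nonnegative [S]-square of [e *: u - v] and divide by [e]. *)
Lemma dot_young m (S : 'M[R]_m) (e : R) u v :
    S^T = S -> (forall x, 0 <= dot (S *m x) x) -> 0 < e ->
  2 * dot (S *m u) v <= e * dot (S *m u) u + e^-1 * dot (S *m v) v.
Proof.
move=> Ssym Sge0 e0; have:= Sge0 (e *: u - v).
rewrite mulmxBr -scalemxAr !(dotDl, dotDr, dotNl, dotNr, dotZl, dotZr).
rewrite [dot (S *m v) u]dot_sym // => H.
have ei : 0 <= e^-1 by rewrite invr_ge0 ltW.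
rewrite -subr_ge0; apply: le_trans (mulr_ge0 ei H) _.
by rewrite le_eqVlt; apply/orP; left; apply/eqP; field; rewrite gt_eqF.
Qed.

End Dot.

(** * Real spectrum and condition number of self-adjoint operators *)

Lemma char_poly_trmx (K : comNzRingType) n (M : 'M[K]_n) :
  char_poly M^T = char_poly M.
Proof.
by rewrite /char_poly -det_tr /char_poly_mx linearB /= tr_scalar_mx map_trmx trmxK.
Qed.

Lemma eigenvalue_colP (F : fieldType) n (M : 'M[F]_n) a :
  reflect (exists2 u : 'cV[F]_n, M *m u = a *: u & u != 0) (eigenvalue M a).
Proof.
rewrite eigenvalue_root_char -(char_poly_trmx M) -eigenvalue_root_char.
apply: (iffP eigenvalueP) => [[v vM v0]|[u Mu u0]].
- exists v^T; last by apply: contra_neq v0 => /(congr1 trmx); rewrite trmxK trmx0.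
  by apply: trmx_inj; rewrite trmx_mul trmxK vM linearZ /= trmxK.
- exists u^T; last by apply: contra_neq u0 => /(congr1 trmx); rewrite trmxK trmx0.
  by rewrite -trmx_mul Mu linearZ.
Qed.

(* A complex eigenvector x + i y for a + i b satisfies
   0 = (M x, y)_A - (x, M y)_A = - b ((x, x)_A + (y, y)_A), whence b = 0. *)
Lemma self_adjoint_eigenvalue (R : realType) n (A M : 'M[R]_n) :
    (0 < n)%N -> spd A ->
    (forall u v, dot (A *m (M *m u)) v = dot (A *m (M *m v)) u) ->
  exists l, eigenvalue M l.
Proof.
move=> n_gt0 Aspd Msa; have [Asym Apos] := Aspd.
pose MC := map_mx (real_complex R) M.
(* The characteristic polynomial has size [n.+1], so [0 < n] makes it nonconstant. *)
have [[a b]] : exists c, root (char_poly MC) c.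
  by apply/closed_rootP; rewrite size_char_poly eqSS -lt0n.
rewrite -eigenvalue_root_char => /eigenvalue_colP[w Mw w0].
pose x := map_mx (@complex.Re R) w; pose y := map_mx (@complex.Im R) w.
have ReM : M *m x = a *: x - b *: y.
  apply/colP => i; move/colP/(_ i)/(congr1 (@complex.Re R)): Mw.
  rewrite !mxE raddf_sum /=; case: (w i 0) => wr wi /= <-.
  by apply: eq_bigr => j _; rewrite !mxE; case: (w j 0) => ? ? /=; ring.
have ImM : M *m y = b *: x + a *: y.
  apply/colP => i; move/colP/(_ i)/(congr1 (@complex.Im R)): Mw.
  rewrite !mxE raddf_sum /=; case: (w i 0) => wr wi /=; rewrite addrC => <-.
  by apply: eq_bigr => j _; rewrite !mxE; case: (w j 0) => ? ? /=; ring.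
have xy0 : (x != 0) || (y != 0).
  rewrite -negb_and; apply: contra_neqN w0 => /andP[/eqP x0 /eqP y0].
  apply/colP => i; move/colP/(_ i): x0; move/colP/(_ i): y0; rewrite !mxE.
  by case: (w i 0) => ? ? /= -> ->.
have pos : 0 < dot (A *m x) x + dot (A *m y) y.
  have [x0|y0] := orP xy0.
  - by rewrite ltr_pwDl ?Apos ?spd_ge0.
  - by rewrite ltr_wpDl ?Apos ?spd_ge0.
have b0 : b = 0.
  have := Msa x y; rewrite ReM ImM mulmxBr mulmxDr -!scalemxAr.
  rewrite !(dotDl, dotNl, dotZl) [dot (A *m y) x]dot_sym // => E.
  apply/eqP; rewrite -(mulIr_eq0 _ (mulIf (lt0r_neq0 pos))); apply/eqP.
  by rewrite mulrDr; lra.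
exists a; apply/eigenvalue_colP.
have [x0|y0] := orP xy0; [exists x => //|exists y => //].
- by rewrite ReM b0 scale0r subr0.
- by rewrite ImM b0 scale0r add0r.
Qed.

(** Testing both form bounds on an eigenvector of eigenvalue [l] gives [1 <= c * l] and [l <= C].
    Self-adjointness ensures that a real eigenvalue exists at all. *)
Lemma spectral_condition_number_le (R : realType) n (A M : 'M[R]_n) (c C : R) :
    (0 < n)%N -> spd A ->
    (forall u v, dot (A *m (M *m u)) v = dot (A *m (M *m v)) u) ->
    0 < c ->
    (forall u, dot (A *m u) u <= c * dot (A *m (M *m u)) u) ->
    (forall u, dot (A *m (M *m u)) u <= C * dot (A *m u) u) ->
  exists kappa, spectral_condition_number M kappa /\ kappa <= c * C.
Proof.
move=> n_gt0 Aspd Msa c0 lo up; have [Asym Apos] := Aspd.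
have bnd l : eigenvalue M l -> 1 <= c * l /\ l <= C.
  case/eigenvalue_colP => u Mu u0; have uu := Apos _ u0.
  have := lo u; have := up u; rewrite Mu -scalemxAr dotZl.
  by rewrite ler_pM2r // mulrA -{1}[dot _ _]mul1r ler_pM2r.
(* The extreme eigenvalues are the two ends of the sorted list of real roots. *)
pose s := sort <=%R (rootsR (char_poly M)).
have M0 : char_poly M != 0 by rewrite monic_neq0 ?char_poly_monic.
have sE l : (l \in s) = eigenvalue M l.
  by rewrite mem_sort -roots_on_rootsR // in_itv /= eigenvalue_root_char.
have [l0] := self_adjoint_eigenvalue n_gt0 Aspd Msa; rewrite -sE => l0s.
have ss : (0 < size s)%N by case: s l0s {sE}.
have sso : sorted <=%R s by apply: sort_sorted; exact: le_total.
have emin : eigenvalue M (nth 0 s 0) by rewrite -sE mem_nth.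
have emax : eigenvalue M (nth 0 s (size s).-1) by rewrite -sE mem_nth // prednK.
exists (nth 0 s (size s).-1 / nth 0 s 0); split.
- exists (nth 0 s 0), (nth 0 s (size s).-1); split=> // l.
  rewrite -sE => /(nthP 0)[i si <-].
  rewrite !(sorted_leq_nth le_trans le_refl) ?inE ?prednK //.
  by rewrite -ltnS prednK.
- have [h1 _] := bnd _ emin; have [h2 h3] := bnd _ emax.
  have minp : 0 < nth 0 s 0 by rewrite -(pmulr_rgt0 _ c0) (lt_le_trans ltr01).
  have maxp : 0 < nth 0 s (size s).-1.
    by rewrite -(pmulr_rgt0 _ c0) (lt_le_trans ltr01).
  rewrite ler_pdivrMr //; apply: le_trans h3 _.
  have C0 : 0 < C by apply: lt_le_trans maxp (bnd _ emax).2.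
  (* Multiply [1 <= c * nth 0 s 0] by [C]. *)
  nra.
Qed.

(** * Spectral truncation and sums over neighbouring subdomains *)

(* The eigenvectors need not be orthogonal: those of different eigenvalues
   are, so that (t - mu_k) (S_b u_k, u_l) = s_k s_l (S_b u_k, u_l) with
   s_k = sqrt (t - mu_k), and t S_b - S_a is a square on the lower part. *)
Lemma eigen_threshold (R : realType) m (Sa Sb : 'M[R]_m)
    (W : {vspace 'cV[R]_m}) d (u : d.-tuple 'cV[R]_m) (mu : 'I_d -> R)
    (t : R) x :
    Sa^T = Sa -> Sb^T = Sb -> (forall y, 0 <= dot (Sb *m y) y) ->
    basis_of W u ->
    (forall k w, w \in W ->
       dot (Sa *m tnth u k) w = mu k * dot (Sb *m tnth u k) w) ->
    x \in W ->
  exists y (c : 'I_d -> R),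
    [/\ x = y + \sum_(k < d | t < mu k) c k *: tnth u k,
        dot (Sa *m y) y <= t * dot (Sb *m y) y
      & dot (Sb *m y) y <= dot (Sb *m x) x].
Proof.
move=> Sa_sym Sb_sym Sb_ge0 uW u_eig xW.
have uinW k : tnth u k \in W by apply: (basis_mem uW); apply: mem_tnth.
pose b k l := dot (Sb *m tnth u k) (tnth u l).
have b0 k l : mu k != mu l -> b k l = 0.
  rewrite -subr_eq0 => mukl; apply: (mulfI mukl); rewrite mulr0 mulrBl.
  rewrite /b -u_eig // [X in _ - _ * X]dot_sym // -u_eig //.
  by rewrite [X in _ - X]dot_sym // subrr.
have bE (P Q : pred 'I_d) (e f : 'I_d -> R) :
    dot (Sb *m \sum_(k | P k) e k *: tnth u k) (\sum_(l | Q l) f l *: tnth u l)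
    = \sum_(k | P k) \sum_(l | Q l) e k * f l * b k l.
  rewrite mulmx_sumr dot_suml; apply: eq_bigr => k _.
  rewrite dot_sumr; apply: eq_bigr => l _.
  by rewrite -scalemxAr dotZl dotZr mulrA.
pose c k := coord u k x.
pose y := \sum_(k | ~~ (t < mu k)) c k *: tnth u k.
pose z := \sum_(k | t < mu k) c k *: tnth u k.
have xyz : x = y + z.
  rewrite {1}(coord_basis uW xW) (bigID (fun k => t < mu k)) /= addrC.
  by congr (_ + _); apply: eq_bigr => k _; rewrite (tnth_nth 0).
exists y, c; split=> //.
- pose s k := Num.sqrt (t - mu k).
  rewrite -subr_ge0; apply: le_trans
    (Sb_ge0 (\sum_(k | ~~ (t < mu k)) (s k * c k) *: tnth u k)) _.
  rewrite le_eqVlt; apply/orP; left; apply/eqP.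
  rewrite !bE /y mulmx_sumr dot_suml mulr_sumr -sumrB; apply: eq_bigr => k kP.
  rewrite -scalemxAr dotZl u_eig; last first.
    by apply: memv_suml => l _; apply: memvZ.
  rewrite dot_sumr !mulr_sumr -sumrB; apply: eq_bigr => l _.
  rewrite dotZr -/(b k l); have [mukl|/b0 ->] := eqVneq (mu k) (mu l); last first.
    by rewrite !mulr0 subrr.
  have skl : s k * s l = t - mu k.
    by rewrite /s -mukl -expr2 sqr_sqrtr // subr_ge0 leNgt.
  by rewrite mulrACA skl; ring.
(* The eigenvalues in [y] are at most [t] and those in [z] exceed it, so the two parts are
   [Sb]-orthogonal and Pythagoras applies. *)
- have yz : dot (Sb *m y) z = 0.
    rewrite bE big1 // => k kP; rewrite big1 // => l lP.
    rewrite b0 ?mulr0 //; rewrite -leNgt in kP.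
    by rewrite lt_eqF // (le_lt_trans kP).
  rewrite xyz mulmxDr !(dotDl, dotDr) yz [dot (Sb *m z) y]dot_sym // yz.
  by rewrite addr0 add0r lerDl Sb_ge0.
Qed.

(** Young's inequality with weight 1 bounds each cross term by the mean of [a i] and [a j]. As [nb]
    is symmetric both halves have the same total, in which each [a i] occurs at most [k0] times. *)
Lemma dot_sum_neighbours (R : realType) n N (A : 'M[R]_n)
    (w : 'I_N -> 'cV[R]_n) (nb : rel 'I_N) (k0 : nat) :
    A^T = A -> (forall x, 0 <= dot (A *m x) x) -> symmetric nb ->
    (forall i j, ~~ nb i j -> dot (A *m w i) (w j) = 0) ->
    (forall i, #|[set j | nb i j]| <= k0)%N ->
  dot (A *m \sum_i w i) (\sum_i w i)
    <= k0%:R * \sum_i dot (A *m w i) (w i).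
Proof.
move=> Asym Age0 nbC nb0 nb_le; pose a i := dot (A *m w i) (w i).
have -> : dot (A *m \sum_i w i) (\sum_i w i)
        = \sum_i \sum_(j | nb i j) dot (A *m w i) (w j).
  rewrite mulmx_sumr dot_suml; apply: eq_bigr => i _.
  by rewrite dot_sumr [RHS]big_mkcond; apply: eq_bigr => j _; case: ifPn => // /nb0.
have half : \sum_i \sum_(j | nb i j) a j = \sum_i \sum_(j | nb i j) a i.
  under eq_bigr do rewrite big_mkcond.
  rewrite exchange_big /=; apply: eq_bigr => i _; rewrite [RHS]big_mkcond.
  by apply: eq_bigr => j _; rewrite nbC.
apply: (@le_trans _ _ (\sum_i \sum_(j | nb i j) a i)).
  rewrite -(ler_pM2l (ltr0Sn R 1)) [leRHS]mulr_natl [leRHS]mulr2n -{1}half.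
  rewrite -big_split mulr_sumr; apply: ler_sum => i _ /=.
  rewrite -big_split mulr_sumr; apply: ler_sum => j _ /=.
  have := dot_young (w i) (w j) Asym Age0 ltr01.
  by rewrite invr1 !mul1r -/(a i) -/(a j) addrC.
rewrite mulr_sumr; apply: ler_sum => i _.
rewrite sumr_const -[leLHS]mulr_natl ler_wpM2r ?Age0 // ler_nat.
by rewrite -cardsE; apply: nb_le.
Qed.

(** * Coarse projection and abstract two-level bounds *)

Lemma coarse_projectionP (R : realType) n m (A : 'M[R]_n) (Z : 'M[R]_(n, m)) :
    spd A -> (forall c : 'cV_m, Z *m c = 0 -> c = 0) ->
  let P := coarse_projection A Z in
  [/\ P^T *m A = A *m P, P *m P = P & P *m Z = Z].
Proof.
move=> Aspd Zinj; have [Asym Apos] := Aspd; pose E := Z^T *m A *m Z.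
have Esym : E^T = E by rewrite /E !trmx_mul trmxK Asym mulmxA.
(* Injectivity of [Z] makes [E] positive definite, so [invmx E] is a true inverse and not a default
   value. *)
have Eu : E \in unitmx.
  apply: spd_unitmx; split=> // c c0.
  suff -> : dot (E *m c) c = dot (A *m (Z *m c)) (Z *m c).
    by apply: Apos; apply: contra_neq c0; apply: Zinj.
  by rewrite dot_mulmxr !mulmxA.
have PZ : coarse_projection A Z *m Z = Z.
  by rewrite /coarse_projection -/E -!mulmxA (mulmxA Z^T) -/E mulVmx ?mulmx1.
split=> //; last by rewrite {2 3}/coarse_projection !mulmxA PZ.
by rewrite /coarse_projection -/E !trmx_mul trmxK trmx_inv Esym Asym !mulmxA.
Qed.

Section TwoLevel.
Variables (R : realType) (n N : nat) (n_ : 'I_N -> nat) (A P : 'M[R]_n).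
Variables (T : forall i, 'M[R]_(n, n_ i)) (B : forall i, 'M[R]_(n_ i)).
Hypotheses (A_spd : spd A) (PA : P^T *m A = A *m P) (PP : P *m P = P).
Hypothesis B_spd : forall i, spd (B i).

Local Notation Q := (1%:M - P).
Local Notation g u i := ((T i)^T *m A *m Q *m u).
Local Notation form u := (dot (A *m (P *m u)) (P *m u)
                          + \sum_i dot (invmx (B i) *m g u i) (g u i)).

Let A_sym : A^T = A. Proof. by case: A_spd. Qed.

Lemma dot_projl (u v : 'cV[R]_n) : dot (A *m (P *m u)) v = dot (A *m u) (P *m v).
Proof. by rewrite mulmxA -PA -mulmxA dot_mulmxl trmxK. Qed.

Lemma dot_cprojl (u v : 'cV[R]_n) : dot (A *m (Q *m u)) v = dot (A *m u) (Q *m v).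
Proof.
by rewrite !mulmxBl !mul1mx mulmxBr !(dotDl, dotDr, dotNl, dotNr) dot_projl.
Qed.

Lemma cproj_idem : Q *m Q = Q.
Proof. by rewrite mulmxBl mul1mx mulmxBr mulmx1 PP subrr subr0. Qed.

Lemma dot_proj_split (u : 'cV[R]_n) : dot (A *m u) u
  = dot (A *m (P *m u)) (P *m u) + dot (A *m (Q *m u)) (Q *m u).
Proof.
rewrite dot_projl dot_cprojl !mulmxA PP cproj_idem -dotDr -mulmxDl.
by rewrite addrC subrK mul1mx.
Qed.

(** Moving [Q] and [T i] to the other side turns [u] into [g u i]; inserting [B i] and its inverse
    gives a pairing to which Young's inequality for [B i] applies. *)
Lemma dot_local (z : forall i, 'cV[R]_(n_ i)) (u : 'cV[R]_n) :
  dot (A *m (Q *m \sum_i T i *m z i)) u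
  = \sum_i dot (B i *m z i) (invmx (B i) *m g u i).
Proof.
rewrite dot_cprojl mulmx_sumr dot_suml; apply: eq_bigr => i _.
have [Bsym _] := B_spd i.
rewrite [RHS]dot_mulmxl Bsym mulKVmx ?spd_unitmx //.
by rewrite dot_mulmxl A_sym dot_mulmxl !mulmxA.
Qed.

(** Split [(A u, u)] into its coarse part and the pairings of [dot_local]. Young with weight [c^-1]
    bounds twice this by [c^-1] times the energy of the decomposition, at most [(A u, u)], plus
    [c * form u]. *)
Lemma two_level_lower (c : R) (u : 'cV[R]_n) (z : forall i, 'cV[R]_(n_ i)) :
    0 < c -> Q *m u = Q *m \sum_i T i *m z i ->
    dot (A *m (P *m u)) (P *m u) + \sum_i dot (B i *m z i) (z i)
      <= c * dot (A *m u) u ->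
  dot (A *m u) u <= c * form u.
Proof.
move=> c0 Qu stable; have ci : 0 < c^-1 by rewrite invr_gt0.
have A_ge0 x : 0 <= dot (A *m x) x by apply: spd_ge0.
have e1 := dot_young (P *m u) (P *m u) A_sym A_ge0 ci.
have e2 : 2 * \sum_i dot (B i *m z i) (invmx (B i) *m g u i)
    <= c^-1 * (\sum_i dot (B i *m z i) (z i))
       + c * \sum_i dot (invmx (B i) *m g u i) (g u i).
  rewrite !mulr_sumr -big_split; apply: ler_sum => i _ /=.
  have B_ge0 x : 0 <= dot (B i *m x) x by apply: spd_ge0.
  have [Bsym _] := B_spd i.
  by have := dot_young (z i) (invmx (B i) *m g u i) Bsym B_ge0 ci;
    rewrite invrK dot_invmx.
rewrite invrK in e1.
have e3 : dot (A *m u) u = dot (A *m (P *m u)) (P *m u)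
    + \sum_i dot (B i *m z i) (invmx (B i) *m g u i).
  rewrite -dot_local -Qu [LHS]dot_proj_split; congr (_ + _).
  by rewrite -dot_cprojl [Q *m (Q *m u)]mulmxA cproj_idem.
have := stable; rewrite -(ler_pM2l ci) mulKf ?gt_eqF // => e4.
move: e1 e2 e3 e4.
set p := dot _ (P *m u); set q := dot _ u; set s := \sum_i _; set t := \sum_i _.
set r := \sum_i _; rewrite !mulrDr; lra.
Qed.

(** For [z i = invmx (B i) *m g u i] the local sum [t] equals the [A]-product of
    [Q *m \sum_i T i *m z i] and [Q *m u]. Young and the bound give [2 t <= t + C |Q u|_A^2]; the
    coarse part only needs [1 <= C]. *)
Lemma two_level_upper (C : R) (u : 'cV[R]_n) :
    1 <= C ->
    (forall z : forall i, 'cV[R]_(n_ i),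
       dot (A *m (Q *m \sum_i T i *m z i)) (Q *m \sum_i T i *m z i)
       <= C * \sum_i dot (B i *m z i) (z i)) ->
  form u <= C * dot (A *m u) u.
Proof.
move=> C1 bound; have C0 : 0 < C by apply: lt_le_trans C1.
have Ci : 0 < C^-1 by rewrite invr_gt0.
have A_ge0 x : 0 <= dot (A *m x) x by apply: spd_ge0.
pose z i := invmx (B i) *m g u i.
have := dot_young (Q *m \sum_i T i *m z i) (Q *m u) A_sym A_ge0 Ci.
have := bound z; rewrite -(ler_pM2l Ci) mulKf ?gt_eqF //.
rewrite -[X in 2 * X <= _]dot_cprojl [Q *m (Q *m _)]mulmxA cproj_idem.
rewrite [X in 2 * X <= _]dot_local.
rewrite -[X in 2 * X <= _]/(\sum_i dot (B i *m z i) (z i)).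
have fE : form u = dot (A *m (P *m u)) (P *m u) + \sum_i dot (B i *m z i) (z i).
  by congr (_ + _); apply: eq_bigr => i _; rewrite dot_invmx.
rewrite fE [dot _ u]dot_proj_split invrK mulrDr.
have := A_ge0 (P *m u).
set p := dot _ (P *m u); set q := dot _ (Q *m u); set t := \sum_i _.
set s := dot _ _ => p0 e1 e2.
have : p <= C * p by rewrite ler_peMl.
lra.
Qed.

End TwoLevel.

(** * Application to the SORAS preconditioner *)

Theorem mainTheorem3 (R : realType) (n : nat) (n_gt0 : (0 < n)%N)
  (* mesh, element bilinear forms, global matrix *)
  (mesh : finType) (a_ : mesh -> {biscalar 'cV[R]_n})
  (a_sym : forall K U V, a_ K U V = a_ K V U)
  (a_psd : forall K U, 0 <= a_ K U U)
  (A : 'M[R]_n) (A_spd : spd A)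
  (A_def : forall U V, dot (A *m U) V = \sum_(K : mesh) a_ K U V)
  (* overlapping subdomains, their degrees of freedom, restriction matrices *)
  (N : nat) (Om : 'I_N -> {set mesh})
  (Om_cover : forall K, exists i, K \in Om i)
  (dofs : mesh -> {set 'I_n})
  (n_ : 'I_N -> nat) (Rm : forall i, 'M[R]_(n_ i, n))
  (Rm_def : forall i,
     boolean_restriction (\bigcup_(K in Om i) dofs K) (Rm i))
  (* partition of unity *)
  (D : forall i, 'M[R]_(n_ i)) (D_diag : forall i, is_diag_mx (D i))
  (D_unity : \sum_(i < N) (Rm i)^T *m D i *m Rm i = 1%:M)
  (* local Neumann matrices *)
  (ANeu : forall i, 'M[R]_(n_ i)) (ANeu_spd : forall i, spd (ANeu i))
  (ANeu_def : forall i (U V : 'cV[R]_n),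
     dot (ANeu i *m (Rm i *m U)) (Rm i *m V) = \sum_(K in Om i) a_ K U V)
  (* near-kernel, local matrices, B_i-orthogonal projections onto G_i = R_i G *)
  (G : {vspace 'cV[R]_n})
  (B : forall i, 'M[R]_(n_ i)) (B_spd : forall i, spd (B i))
  (xi : forall i, 'M[R]_(n_ i))
  (xi_def : forall i, orthB_projection (B i) (mximg (Rm i) G) (xi i))
  (tau gamma : R) (tau_gt0 : 0 < tau) (gamma_gt0 : 0 < gamma)
  (* first generalised eigenproblem *)
  (V : forall j, (n_ j).-tuple 'cV[R]_(n_ j))
  (lambda : forall j, 'I_(n_ j) -> R)
  (V_basis : forall j, basis_of fullv (V j))
  (V_eigen : forall j k,
     (1%:M - (xi j)^T) *m B j *m (1%:M - xi j) *m tnth (V j) k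
     = lambda j k *: (ANeu j *m tnth (V j) k))
  (* second generalised eigenproblem *)
  (d_ : 'I_N -> nat) (U : forall i, (d_ i).-tuple 'cV[R]_(n_ i))
  (mu : forall i, 'I_(d_ i) -> R)
  (U_basis : forall i, basis_of (orthB (B i) (mximg (Rm i) G)) (U i))
  (U_eigen : forall i k W, W \in orthB (B i) (mximg (Rm i) G) ->
     dot (D i *m Rm i *m A *m (Rm i)^T *m D i *m tnth (U i) k) W
     = mu i k * dot (B i *m tnth (U i) k) W)
  (* coarse space basis *)
  (m : nat) (Z : 'M[R]_(n, m))
  (Z_basis : basis_of (coarse_G Rm D G + coarse_tau Rm D xi V lambda tau
                       + coarse_gamma Rm D U mu gamma)%VS
                      [tuple col k Z | k < m]) :
  let Minv := soras2 A Rm D B Z in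
  let k0 := max_neighbours A Rm in
  let k1 := max_multiplicity Om in
  spd Minv /\
  exists kappa : R, spectral_condition_number (Minv *m A) kappa /\
    kappa <= (1 + k1%:R * tau) * Num.max 1 (k0%:R * gamma).
Proof.
move=> Minv k0 k1; have [Asym Apos] := A_spd.
have Bsym i : (B i)^T = B i by have [] := B_spd i.
have Dsym i : (D i)^T = D i by have /diag_mxP[d ->] := D_diag i; apply: tr_diag_mx.
have xiT i : (1%:M - xi i)^T = 1%:M - (xi i)^T by rewrite linearB /= trmx1.
pose W0 := (coarse_G Rm D G + coarse_tau Rm D xi V lambda tau
            + coarse_gamma Rm D U mu gamma)%VS.
have sumZ (c : 'cV[R]_m) : Z *m c = \sum_k c k 0 *: tnth [tuple col k Z | k < m] k.
  apply/colP => i; rewrite mxE summxE; apply: eq_bigr => k _.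
  by rewrite tnth_mktuple !mxE mulrC.
have Zinj (c : 'cV[R]_m) : Z *m c = 0 -> c = 0.
  move=> Zc0; apply/colP => k; rewrite mxE.
  have /freeP Zfree := basis_free Z_basis.
  apply: (Zfree (fun k => c k 0)); rewrite -[RHS]Zc0 sumZ.
  by apply: eq_bigr => j _; rewrite (tnth_nth 0).
have [PA PP PZ] := coarse_projectionP A_spd Zinj.
pose S := \sum_i (Rm i)^T *m D i *m invmx (B i) *m D i *m Rm i.
have ME : Minv = coarse_projection A Z *m invmx A
  + (1%:M - coarse_projection A Z) *m S *m (1%:M - (coarse_projection A Z)^T) by [].
(* From here on [P] is opaque: an [A]-self-adjoint idempotent that fixes the columns of [Z]. *)
move: (coarse_projection A Z) PA PP PZ ME => P PA PP PZ; clearbody Minv => ME.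
have Q0 v : v \in W0 -> (1%:M - P) *m v = 0.
  move=> vW0; suff [c ->] : exists c, v = Z *m c.
    by rewrite mulmxA mulmxBl mul1mx PZ subrr mul0mx.
  exists (\col_k coord [tuple col k Z | k < m] k v).
  rewrite sumZ [LHS](coord_basis Z_basis vW0); apply: eq_bigr => k _.
  by rewrite mxE (tnth_nth 0).
pose T i := (Rm i)^T *m D i.
have TT i : (T i)^T = D i *m Rm i by rewrite trmx_mul trmxK Dsym.
have TG_W0 i v : v \in mximg (Rm i) G -> T i *m v \in W0.
  move=> vG; apply/(subvP (addvSl _ _))/(subvP (addvSl _ _)).
  apply: (subvP (sumv_sup i _ (subvv _))) => //.
  by have := memv_img (linfun (mulmx (T i))) vG; rewrite lfunE.
have Ttau_W0 i k : tau < lambda i k ->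
    T i *m ((1%:M - xi i) *m tnth (V i) k) \in W0.
  move=> tau_lt; apply/(subvP (addvSl _ _))/(subvP (addvSr _ _)).
  apply: (subvP (sumv_sup i _ (subvv _))) => //.
  apply: (subvP (sumv_sup k _ (subvv _))) => //.
  by rewrite mulmxA memv_line.
have Tgamma_W0 i k : gamma < mu i k -> T i *m tnth (U i) k \in W0.
  move=> gamma_lt; apply: (subvP (addvSr _ _)).
  apply: (subvP (sumv_sup i _ (subvv _))) => //.
  apply: (subvP (sumv_sup k _ (subvv _))) => //.
  exact: memv_line.
have Minv_sym : Minv^T = Minv.
  (* Conjugating [P^T *m A = A *m P] by the inverse of [A] shows that [P *m invmx A] is
     symmetric. *)
  have PAi : (P *m invmx A)^T = P *m invmx A.
    rewrite trmx_mul trmx_inv Asym -[P^T](mulmxK (spd_unitmx A_spd)) PA.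
    by rewrite !mulmxA mulVmx ?mul1mx ?spd_unitmx.
  have QT : (1%:M - P^T)^T = 1%:M - P by rewrite linearB /= trmx1 trmxK.
  rewrite ME linearD /= PAi; congr (_ + _); rewrite trmx_mul QT trmx_mul -QT trmxK.
  rewrite mulmxA; congr (_ *m _ *m _).
  rewrite linear_sum; apply: eq_bigr => i _ /=.
  by rewrite !trmx_mul trmxK trmx_inv Bsym Dsym !mulmxA.
have Msa u v : dot (A *m (Minv *m A *m u)) v = dot (A *m (Minv *m A *m v)) u.
  have sym : (A *m Minv *m A)^T = A *m Minv *m A.
    by rewrite !trmx_mul Minv_sym Asym mulmxA.
  by rewrite !mulmxA; apply: dot_sym.
have formE u : dot (A *m (Minv *m A *m u)) u
    = dot (A *m (P *m u)) (P *m u)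
      + \sum_i dot (invmx (B i) *m ((T i)^T *m A *m (1%:M - P) *m u))
                   ((T i)^T *m A *m (1%:M - P) *m u).
  (* This puts the second term of [Minv *m A *m u] in the form required by [dot_local], with
     [B_i^-1 g_i] as local vectors. *)
  have AQ : (1%:M - P^T) *m A = A *m (1%:M - P).
    by rewrite mulmxBl mulmxBr mul1mx mulmx1 PA.
  rewrite ME 2!mulmxDl mulmxDr dotDl; congr (_ + _).
    rewrite mulmxKV ?spd_unitmx // -(dot_projl PA).
    by rewrite [P *m (P *m u)]mulmxA PP.
  rewrite -!(mulmxA (1%:M - P)).
  have -> : S *m (1%:M - P^T) *m A *m u
      = \sum_i T i *m (invmx (B i) *m ((T i)^T *m A *m (1%:M - P) *m u)).
    rewrite -!mulmxA (mulmxA (1%:M - P^T)) AQ mulmx_suml.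
    by apply: eq_bigr => i _; rewrite TT !mulmxA.
  rewrite (dot_local T A_spd PA B_spd); apply: eq_bigr => i _.
  by rewrite dot_invmx.
have k0P i : (#|[set j | (Rm j *m A *m (Rm i)^T != 0)%R]| <= k0)%N.
  exact: (@leq_bigmax _ (fun i => #|[set j | (Rm j *m A *m (Rm i)^T != 0)%R]|)).
have k1P K : (#|[set i | K \in Om i]| <= k1)%N.
  exact: (@leq_bigmax _ (fun K => #|[set i | K \in Om i]|)).
(* The spectrum of [Minv *m A] will lie between [c^-1] and [C]. *)
pose c : R := 1 + k1%:R * tau; pose C := Num.max 1 (k0%:R * gamma).
have c0 : 0 < c by rewrite ltr_pwDl // mulr_ge0 ?ler0n // ltW.
have lower u : dot (A *m u) u <= c * dot (A *m (Minv *m A *m u)) u.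
  have /fin_all_exists[y yP] i : exists y,
      (1%:M - P) *m (T i *m (Rm i *m u))
        = (1%:M - P) *m (T i *m ((1%:M - xi i) *m y))
      /\ dot (B i *m ((1%:M - xi i) *m y)) ((1%:M - xi i) *m y)
         <= tau * dot (ANeu i *m (Rm i *m u)) (Rm i *m u).
    have [ANsym _] := ANeu_spd i.
    have [|x|k w _||y [cc [xE yle yle']]] := @eigen_threshold R _
      ((1%:M - (xi i)^T) *m B i *m (1%:M - xi i)) (ANeu i) fullv _ (V i)
      (lambda i) tau (Rm i *m u) _ ANsym _ (V_basis i).
    - by rewrite !trmx_mul -xiT trmxK Bsym mulmxA.
    - exact: spd_ge0.
    - by rewrite V_eigen dotZl.
    - exact: memvf.
    exists y; split; last first.
      apply: le_trans (_ : tau * dot (ANeu i *m y) y <= _); last by rewrite ler_pM2l.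
      apply: le_trans yle; rewrite dot_mulmxr xiT.
      by rewrite !mulmxA.
    apply/eqP; rewrite -subr_eq0 -!mulmxBr; apply/eqP/Q0.
    (* The discarded part is a vector of [G_i] plus [1 - xi_i] applied to the eigenvectors above
       [tau]; [T i] sends both into the coarse space. *)
    have -> : Rm i *m u - (1%:M - xi i) *m y = xi i *m (Rm i *m u)
        + \sum_(k | tau < lambda i k) cc k *: ((1%:M - xi i) *m tnth (V i) k).
      have -> : \sum_(k | tau < lambda i k) cc k *: ((1%:M - xi i) *m tnth (V i) k)
              = (1%:M - xi i) *m (Rm i *m u - y).
        rewrite [in RHS]xE [y + _]addrC addrK mulmx_sumr.
        by apply: eq_bigr => k _; rewrite -scalemxAr.
      by rewrite mulmxBr addrA -mulmxDl [xi i + _]addrC subrK mul1mx.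
    rewrite mulmxDr memvD //; first by apply: TG_W0; case: (xi_def i (Rm i *m u)).
    rewrite mulmx_sumr memv_suml // => k tau_lt.
    by rewrite -scalemxAr memvZ // Ttau_W0.
  rewrite formE; apply: (two_level_lower A_spd PA PP B_spd
    (z := fun i => (1%:M - xi i) *m y i)) => //.
    have {1}-> : u = \sum_i T i *m (Rm i *m u).
      rewrite -[LHS]mul1mx -D_unity mulmx_suml.
      by apply: eq_bigr => i _; rewrite !mulmxA.
    by rewrite !mulmx_sumr; apply: eq_bigr => i _; have [] := yP i.
  (* In [c], the 1 pays for the coarse energy and [k1 * tau] for the local energies. *)
  rewrite mulrDl mul1r lerD //.
    by rewrite (dot_proj_split PA PP u) lerDl spd_ge0.
  apply: (@le_trans _ _ (\sum_i tau * \sum_(K in Om i) a_ K u u)).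
    by apply: ler_sum => i _; rewrite -ANeu_def; have [] := yP i.
  rewrite -mulr_sumr [_ * tau]mulrC -mulrA ler_pM2l // A_def.
  (* Summing by elements instead of subdomains, each nonnegative [a_ K u u] is counted at most [k1]
     times. *)
  under eq_bigr do rewrite big_mkcond.
  rewrite exchange_big mulr_sumr /=; apply: ler_sum => K _.
  rewrite -big_mkcond sumr_const -[leLHS]mulr_natl ler_wpM2r // ler_nat.
  by rewrite -cardsE; apply: k1P.
have upper u : dot (A *m (Minv *m A *m u)) u <= C * dot (A *m u) u.
  rewrite formE; apply: (two_level_upper A_spd PA PP B_spd).
    by rewrite le_max lexx.
  move=> z.
  have /fin_all_exists[y yP] i : exists y,
      [/\ (1%:M - P) *m (T i *m z i) = (1%:M - P) *m (T i *m y),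
          dot (A *m (T i *m y)) (T i *m y) <= gamma * dot (B i *m y) y
        & dot (B i *m y) y <= dot (B i *m z i) (z i)].
    have [xiG xiO] := xi_def i (z i); have B_ge0 y := spd_ge0 y (B_spd i).
    (* The second eigenproblem lives on the [B_i]-orthogonal complement of [G_i], so [z i] first
       loses its projection on [G_i]. *)
    have [|k w wO|y [cc [xE yle yle']]] := @eigen_threshold R _
      (D i *m Rm i *m A *m (Rm i)^T *m D i) (B i) _ _ (U i)
      (mu i) gamma (z i - xi i *m z i) _ (Bsym i) B_ge0 (U_basis i) _ xiO.
    - by rewrite !trmx_mul trmxK Dsym Asym !mulmxA.
    - exact: U_eigen.
    exists y; split.
    + apply/eqP; rewrite -subr_eq0 -!mulmxBr; apply/eqP/Q0.
      have -> : z i - y = xi i *m z i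
          + \sum_(k | gamma < mu i k) cc k *: tnth (U i) k.
        by apply/eqP; rewrite subr_eq -addrA [_ + y]addrC -xE addrC subrK.
      rewrite mulmxDr memvD //; first exact: TG_W0.
      rewrite mulmx_sumr memv_suml // => k gamma_lt.
      by rewrite -scalemxAr memvZ // Tgamma_W0.
    + by apply: le_trans yle; rewrite dot_mulmxr TT !mulmxA.
    (* By [B_i]-orthogonality, removing the component in [G_i] does not increase the
       [B_i]-energy. *)
    + apply: le_trans yle' _; move: (xi i *m z i) xiG xiO => w wG.
      move=> /mem_orthB/(_ _ wG); rewrite -[z i in leRHS](subrK w).
      move: (z i - w) => x xw; rewrite mulmxDr !(dotDl, dotDr) xw.
      by rewrite [dot (B i *m w) x]dot_sym // xw addr0 add0r lerDl B_ge0.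
  have -> : (1%:M - P) *m \sum_i T i *m z i = (1%:M - P) *m \sum_i T i *m y i.
    by rewrite !mulmx_sumr; apply: eq_bigr => i _; case: (yP i).
  set s := \sum_i T i *m y i.
  (* [Q] is an [A]-orthogonal projection, hence does not increase the [A]-energy. *)
  apply: (@le_trans _ _ (dot (A *m s) s)).
    by rewrite [leRHS](dot_proj_split PA PP) lerDr spd_ge0.
  (* The [A]-product of [T i *m y i] and [T j *m y j] passes through the block [R_j A R_i^T], whose
     nonvanishing defines neighbours. *)
  have nbC : symmetric (fun i j => Rm j *m A *m (Rm i)^T != 0).
    move=> i j; congr (~~ _).
    by rewrite -(inj_eq trmx_inj) !trmx_mul trmxK Asym trmx0 mulmxA.
  apply: le_trans (dot_sum_neighbours Asym _ nbC _ k0P) _.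
  - by move=> x; apply: spd_ge0.
  - move=> i j; rewrite negbK => /eqP nb0.
    rewrite /T -[X in dot _ X]mulmxA [LHS]dot_mulmxr trmxK !mulmxA nb0.
    by rewrite !mul0mx dot0l.
  apply: (@le_trans _ _ (k0%:R * gamma * \sum_i dot (B i *m z i) (z i))).
    rewrite -mulrA ler_wpM2l // mulr_sumr; apply: ler_sum => i _.
    by have [_ le1 le2] := yP i; apply: le_trans le1 _; rewrite ler_pM2l.
  rewrite ler_wpM2r ?le_max ?lexx ?orbT // sumr_ge0 // => i _.
  exact: spd_ge0.
split; last exact: spectral_condition_number_le A_spd Msa c0 lower upper.
split=> // f f0; have Au := spd_unitmx A_spd.
(* At [A^-1 f] the lower bound reads [(A^-1 f, f) <= c (Minv f, f)], which gives positivity. *)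
have := lower (invmx A *m f).
rewrite -(mulmxA Minv) (mulKVmx Au) [X in c * X]dot_mulmxl Asym (mulKVmx Au) => le.
rewrite -(pmulr_rgt0 _ c0); apply: lt_le_trans le.
suff: invmx A *m f != 0 by move/Apos; rewrite mulKVmx.
by apply: contra_neq f0 => /(congr1 (mulmx A)); rewrite mulKVmx // mulmx0.
Qed.
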